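(* Every real orthogonal $n\times n$ matrix $U$ admits a representation $$U = D(I-S)(I+S)^{-1},$$ where $D$ is an $n\times n$ diagonal matrix with diagonal entries in $\{-1,1\}$ and $S$ is a real skew-symmetric $n\times n$ matrix. Such a representation (that is, such a pair $(D,S)$) can be computed from $U$ in $O(n^{3})$ arithmetic operations.
   Context: $I$ denotes the $n\times n$ identity matrix. A real $n\times n$ matrix $U$ is orthogonal if $UU^{T}=U^{T}U=I$, and a real matrix $S$ is skew-symmetric if $S^{T}=-S$. The operation count refers to exact arithmetic operations on real scalars. *)

(* Defs.v *)
From HB Require Import structures.
From mathcomp Require Import all_boot all_order all_algebra.
From mathcomp Require Import reals.

Set Implicit Arguments.
Unset Strict Implicit.
Unset Printing Implicit Defensive.

Import Order.TTheory GRing.Theory Num.Theory.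
Local Open Scope ring_scope.

Definition orthogonal_mx (R : realType) (n : nat) (U : 'M[R]_n) : Prop :=
  U *m U^T = 1%:M /\ U^T *m U = 1%:M.

Definition skew_mx (R : realType) (n : nat) (S : 'M[R]_n) : Prop :=
  S^T = - S.

Definition sign_diag_mx (R : realType) (n : nat) (D : 'M[R]_n) : Prop :=
  is_diag_mx D /\ forall i : 'I_n, D i i = -1 \/ D i i = 1.

(* [invmx] is total, so the existence of the inverse is stated separately. *)
Definition cayley_rep (R : realType) (n : nat) (U D S : 'M[R]_n) : Prop :=
  [/\ sign_diag_mx D, skew_mx S, 1%:M + S \in unitmx
    & U = D *m (1%:M - S) *m invmx (1%:M + S)].

(* Algorithms are while-programs over a real RAM: natural-number registers   *)
(* for sizes and subscripts, and two-dimensional arrays of exact real        *)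
(* numbers.  A program is a single finite piece of syntax which reads the    *)
(* dimension n at run time, so it is uniform in n.  Natural numbers are      *)
(* never converted to reals or reals to natural numbers: real data affect    *)
(* the control flow only through comparisons.                                *)

(* [Isub] is truncated subtraction. *)
Inductive iexp : Type :=
  | Inat of nat
  | Ireg of nat
  | Iadd of iexp & iexp
  | Isub of iexp & iexp
  | Imul of iexp & iexp.

Inductive arith : Type := Oadd | Osub | Omul | Odiv.

(* [Rget a e1 e2] is the entry (e1, e2), counted from 0, of array number a. *)
Inductive rexp : Type :=
  | Rlit of int
  | Rget of nat & iexp & iexp
  | Rop of arith & rexp & rexp.

Inductive test : Type :=
  | Ilt of iexp & iexp
  | Rle of rexp & rexp
  | Tnot of test.

Inductive prog : Type :=
  | Skip
  | Iset of nat & iexp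
  | Rset of nat & iexp & iexp & rexp
  | Seq of prog & prog
  | If of test & prog & prog
  | While of test & prog.

Record state (R : realType) : Type := State {
  reg : nat -> nat;
  arr : nat -> nat -> nat -> R
}.

Definition set_reg (R : realType) (s : state R) (x v : nat) : state R :=
  State (fun y => if y == x then v else reg s y) (arr s).

Definition set_arr (R : realType) (s : state R) (a i j : nat) (v : R) :
    state R :=
  State (reg s) (fun b k l =>
    if [&& b == a, k == i & l == j] then v else arr s b k l).

Fixpoint ieval (R : realType) (s : state R) (e : iexp) : nat :=
  match e with
  | Inat m => m
  | Ireg x => reg s x
  | Iadd e1 e2 => (ieval s e1 + ieval s e2)%N
  | Isub e1 e2 => (ieval s e1 - ieval s e2)%N
  | Imul e1 e2 => (ieval s e1 * ieval s e2)%N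
  end.

Definition arith_eval (R : realType) (o : arith) (x y : R) : option R :=
  match o with
  | Oadd => Some (x + y)
  | Osub => Some (x - y)
  | Omul => Some (x * y)
  | Odiv => if y == 0 then None else Some (x / y)
  end.

(* [None] signals a division by zero. *)
Fixpoint reval (R : realType) (s : state R) (e : rexp) : option R :=
  match e with
  | Rlit z => Some z%:~R
  | Rget a e1 e2 => Some (arr s a (ieval s e1) (ieval s e2))
  | Rop o e1 e2 =>
      match reval s e1, reval s e2 with
      | Some x, Some y => arith_eval o x y
      | _, _ => None
      end
  end.

Fixpoint teval (R : realType) (s : state R) (t : test) : option bool :=
  match t with
  | Ilt e1 e2 => Some (ieval s e1 < ieval s e2)%N
  | Rle e1 e2 =>
      match reval s e1, reval s e2 with
      | Some x, Some y => Some (x <= y)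
      | _, _ => None
      end
  | Tnot t1 => omap negb (teval s t1)
  end.

(* Every addition, subtraction, multiplication, division and comparison of   *)
(* reals costs 1; subscript bookkeeping, literals and copies are free.       *)
Fixpoint rcost (e : rexp) : nat :=
  match e with
  | Rop _ e1 e2 => (rcost e1 + rcost e2).+1
  | _ => 0
  end.

Fixpoint tcost (t : test) : nat :=
  match t with
  | Ilt _ _ => 0
  | Rle e1 e2 => (rcost e1 + rcost e2).+1
  | Tnot t1 => tcost t1
  end.

(* [exec p s s' k]: run from s, the program p halts in s' after exactly k    *)
(* operations on reals.  A run that divides by zero or diverges has no       *)
(* derivation.  See [exec_det] for determinism.                              *)
Inductive exec (R : realType) : prog -> state R -> state R -> nat -> Prop :=
  | exec_skip s : exec Skip s s 0
  | exec_iset s x e : exec (Iset x e) s (set_reg s x (ieval s e)) 0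
  | exec_rset s a e1 e2 e v :
      reval s e = Some v ->
      exec (Rset a e1 e2 e) s
        (set_arr s a (ieval s e1) (ieval s e2) v) (rcost e)
  | exec_seq p q s s1 s2 k l :
      exec p s s1 k -> exec q s1 s2 l -> exec (Seq p q) s s2 (k + l)
  | exec_if t p q s s' b k :
      teval s t = Some b -> exec (if b then p else q) s s' k ->
      exec (If t p q) s s' (tcost t + k)
  | exec_while_stop t p s :
      teval s t = Some false -> exec (While t p) s s (tcost t)
  | exec_while_step t p s s1 s2 k l :
      teval s t = Some true -> exec p s s1 k -> exec (While t p) s1 s2 l ->
      exec (While t p) s s2 (tcost t + k + l).

Lemma exec_det (R : realType) (p : prog) (s s1 s2 : state R) (k1 k2 : nat) :
  exec p s s1 k1 -> exec p s s2 k2 -> s1 = s2 /\ k1 = k2.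
Proof.
move=> H; elim: H s2 k2 => {p s s1 k1}.
- by move=> s s2 k2 H; inversion H.
- by move=> s x e s2 k2 H; inversion H.
- by move=> s a e1 e2 e v Hv s2 k2 H; inversion H; subst; split=> //; congruence.
- move=> p q s s1 s2 k l _ IHp _ IHq s3 k3 H; inversion H; subst.
  by have [? ?] := IHp _ _ H2; subst; have [? ?] := IHq _ _ H6; subst.
- move=> t p q s s' b k Hb _ IH s2 k2 H; inversion H; subst.
  have Eb : b = b0 by congruence.
  by subst; have [? ?] := IH _ _ H7; subst.
- by move=> t p s Ht s2 k2 H; inversion H; subst => //; congruence.
- move=> t p s s1 s2 k l Ht _ IHp _ IHw s3 k3 H; inversion H; subst.
    by congruence.
  by have [? ?] := IHp _ _ H3; subst; have [? ?] := IHw _ _ H7; subst.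
Qed.

(* Register 0 holds n and array 0 holds U; everything else is initially 0. *)
Definition init_state (R : realType) (n : nat) (U : 'M[R]_n) : state R :=
  State (fun x => if x == 0%N then n else 0%N)
        (fun a i j => if a == 0%N then
           match @insub nat (fun k => k < n)%N 'I_n i,
                 @insub nat (fun k => k < n)%N 'I_n j with
           | Some i', Some j' => U i' j'
           | _, _ => 0
           end
         else 0).

Definition read_mx (R : realType) (n : nat) (s : state R) (a : nat) : 'M[R]_n :=
  \matrix_(i < n, j < n) arr s a i j.

(* On input U, p outputs D in array 1 and S in array 2. *)
Definition computes_in (R : realType) (n : nat) (p : prog)
    (U D S : 'M[R]_n) (k : nat) : Prop :=
  exists s : state R,
    [/\ exec p (init_state U) s k, D = read_mx n s 1 & S = read_mx n s 2].

(* Main.v *)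
Require Import Defs.
From HB Require Import structures.
From mathcomp Require Import all_boot all_order all_algebra.
From mathcomp Require Import reals ring zify.

Set Implicit Arguments.
Unset Strict Implicit.
Unset Printing Implicit Defensive.

Import Order.TTheory GRing.Theory Num.Theory.
Local Open Scope ring_scope.

(** For V = D U, the equation U = D (I - S) (I + S)^-1 says that S is the
    Cayley transform of V, that is S (I + V) = I - V.  In terms of y = U x, the
    matrix S maps x + D y to x - D y.  The transform exists as soon as I + D U
    is invertible, and D can be chosen to ensure this, one sign at a time.

    The transform is performed one coordinate at a time.  After k steps the
    current matrix A maps the vector u to the vector v, where
    (u_i, v_i) = (x_i + d_i y_i, x_i - d_i y_i) for i < k, and
    (u_i, v_i) = (x_i, y_i) for the other i ([partial_cayley]).  At the start
    D = 0 and A = U; after n steps A = S.  Step k replaces u_k = x_k by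
    u_k + d v_k = u_k + d (A u)_k, a linear change of variables with
    determinant 1 + d A_kk.  Choosing for d the sign of A_kk makes this pivot
    1 + |A_kk| >= 1, so no pivot search and no division by zero occurs.  The
    new A is a sum of A and two outer products ([cayley_update],
    [cayley_update_correct]), so a step costs O(n^2) and the computation
    O(n^3).

    That S is what is wanted then follows from S (I + V) = I - V alone
    ([cayley_rep_of_partial]): it gives (I + S) (I + V) = 2 I, hence the
    invertibility of both factors, and the orthogonality of V makes S skew.

    The program copies U to array 2, where it keeps A, and D is in array 1.
    Before an update, A is copied back to array 0, so that every entry is
    computed from arrays which are not being overwritten.  The program
    is verified with a total-correctness triple that bounds the number of
    operations ([within]).  The existence of (D, S) is a consequence of the
    correctness of the program. *)

(** * Cayley transform, one coordinate at a time *)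

Definition partial_sign_diag (R : realType) n (m : nat) (D : 'M[R]_n) : Prop :=
  is_diag_mx D /\
  forall i : 'I_n, if (i < m)%N then D i i = -1 \/ D i i = 1 else D i i = 0.

(** Since D has entries 0, 1 and -1, the matrix D D is the projection on the
    coordinates already treated; the right-hand side maps x to the vector whose
    entry i is x_i - d_i y_i if i is treated and y_i otherwise, for y = U x. *)
Definition partial_cayley (R : realType) n (U D A : 'M[R]_n) : Prop :=
  A *m (1%:M + D *m U) = U + D *m D - D *m U - D *m D *m U.

Definition pivot_sign (R : realType) n (A : 'M[R]_n) (k : 'I_n) : R :=
  if 0 <= A k k then 1 else -1.

(** The pair (u_k, v_k) is replaced by (u_k + d v_k, u_k - d v_k) in v = A u.
    Column k of D, which is d times the unit vector e_k, supplies e_k, so that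
    an entry of the update is an expression in entries of A and D.  As
    d^2 = 1, the products with D amount to e_k e_k^T and
    (d A e_k + (1 + 2 d) e_k) (e_k^T A). *)
Definition cayley_update (R : realType) n (A D : 'M[R]_n) (k : 'I_n) :
    'M[R]_n :=
  A + col k D *m row k D
  - (1 + D k k * A k k)^-1 *:
      (col k (D k k *: A + (D k k + 2) *: D) *m row k A).

Lemma pivot_sign_cases (R : realType) n (A : 'M[R]_n) k :
  pivot_sign A k = -1 \/ pivot_sign A k = 1.
Proof. by rewrite /pivot_sign; case: ifP; [right | left]. Qed.

Lemma pivot_neq0 (R : realType) n (A : 'M[R]_n) k :
  1 + pivot_sign A k * A k k != 0.
Proof.
apply: lt0r_neq0; rewrite /pivot_sign; case: (lerP 0 (A k k)) => Akk.
  by rewrite mul1r ltr_pwDl.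
by rewrite mulN1r ltr_pwDl // oppr_ge0 ltW.
Qed.

Lemma partial_sign_diag0 (R : realType) n : partial_sign_diag 0 (0 : 'M[R]_n).
Proof. by split=> [|i]; [exact: mx0_is_diag | rewrite ltn0 mxE]. Qed.

Lemma partial_sign_diagS (R : realType) n (D : 'M[R]_n) (k : 'I_n) (d : R) :
  partial_sign_diag k D -> d = -1 \/ d = 1 ->
  partial_sign_diag k.+1 (D + d *: delta_mx k k).
Proof.
case=> /is_diag_mxP Ddiag Dval Hd; split.
  apply/is_diag_mxP => i j ij; rewrite !mxE Ddiag //.
  case: andP => [[/eqP ik /eqP jk]|_]; last by rewrite mulr0 addr0.
  by rewrite ik jk eqxx in ij.
move=> i; rewrite !mxE; have := Dval i; rewrite ltnS [(i <= k)%N]leq_eqVlt.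
have [->|ik] := eqVneq i k.
  by rewrite ltnn eqxx => ->; rewrite mulr1 add0r.
by rewrite mulr0 addr0 -[(i == k :> nat)]/(i == k) (negbTE ik).
Qed.

(** Everything reduces to the two facts that row k of A (I + D U) is row k of
    U, because k is not yet treated, and that row k of A times e_k is A_kk.  The
    right multiplication of the update by the increment d e_k (e_k^T U) of
    I + D U then produces the same outer product as the division by the pivot
    leaves, with coefficients that add up to 1. *)
Lemma cayley_update_correct (R : realType) n (U D A : 'M[R]_n) (k : 'I_n) :
  let D' := D + pivot_sign A k *: delta_mx k k in
  partial_sign_diag k D -> partial_cayley U D A ->
  partial_cayley U D' (cayley_update A D' k).
Proof.
set d := pivot_sign A k => D' [/is_diag_mxP Ddiag Dval] AX.
have dd : d * d = 1.
  by case: (pivot_sign_cases A k); rewrite -/d => ->; rewrite ?mulrNN mulr1.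
have q0 : 1 + d * A k k != 0 by exact: pivot_neq0.
have Dkk : D k k = 0 by have := Dval k; rewrite ltnn.
pose e : 'cV[R]_n := delta_mx k 0; pose f : 'rV[R]_n := delta_mx 0 k.
have D'E : D' = D + d *: (e *m f) by rewrite /D' /e /f mul_delta_mx.
have De : D *m e = 0.
  rewrite -colE; apply/colP => i; rewrite !mxE.
  by have [->|ik] := eqVneq i k; [exact: Dkk | apply: Ddiag].
have fD : f *m D = 0.
  rewrite -rowE; apply/rowP => i; rewrite !mxE.
  by have [<-|ik] := eqVneq k i; [exact: Dkk | apply: Ddiag].
have fe : f *m e = 1%:M.
  by rewrite /f /e mul_delta_mx; apply/matrixP => i j; rewrite !mxE !ord1.
have D'kk : D' k k = d by rewrite !mxE Dkk !eqxx add0r mulr1.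
have cD : col k D' = d *: e.
  by rewrite colE -/e D'E mulmxDl De add0r -scalemxAl -mulmxA fe mulmx1.
have rD : row k D' = d *: f.
  by rewrite rowE -/f D'E mulmxDr fD add0r -scalemxAr mulmxA fe mul1mx.
pose u := f *m U; pose a := A *m e; pose r := f *m A.
have rX : r *m (1%:M + D *m U) = u.
  rewrite /r -mulmxA AX !(mulmxDr, mulmxN, mulmxBr) !mulmxA fD !mul0mx.
  by rewrite !subr0 addr0.
have re : r *m e = (A k k)%:M.
  by rewrite /r /e -rowE -colE; apply/matrixP => i j; rewrite !mxE !ord1.
have fX : f *m (1%:M + D *m U) = f.
  by rewrite mulmxDr mulmx1 mulmxA fD mul0mx addr0.
pose w : 'cV[R]_n := d *: a + (1 + 2 * d) *: e.
have A'E : cayley_update A D' k = A + e *m f - (1 + d * A k k)^-1 *: (w *m r).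
  rewrite /cayley_update D'kk cD rD -scalemxAl -scalemxAr scalerA dd scale1r.
  congr (_ + _ - _ *: (_ *m _)); last by rewrite rowE.
  (* d (d + 2) = 1 + 2 d since d^2 = 1 *)
  rewrite colE -/e mulmxDl -!scalemxAl -/a -(colE k D') cD scalerA mulrDl dd.
  by congr (_ + _ *: _); rewrite addrC.
have D'U : D' *m U = D *m U + d *: (e *m u).
  by rewrite D'E mulmxDl -scalemxAl -mulmxA.
have D'D' : D' *m D' = D *m D + e *m f.
  rewrite D'E mulmxDl !mulmxDr -!(scalemxAl, scalemxAr) -!mulmxA fD.
  rewrite (mulmxA D) De mul0mx mulmx0 !(scaler0, addr0, add0r).
  by rewrite (mulmxA f) fe mul1mx scalerA dd scale1r.
have A'X : cayley_update A D' k *m (1%:M + D *m U) =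
    A *m (1%:M + D *m U) + e *m f - (1 + d * A k k)^-1 *: (w *m u).
  rewrite A'E mulmxBl mulmxDl -scalemxAl -(mulmxA e) fX.
  by rewrite -(mulmxA w) rX.
have A'eu : cayley_update A D' k *m (e *m u) =
    a *m u + e *m u - ((1 + d * A k k)^-1 * A k k) *: (w *m u).
  rewrite mulmxA A'E mulmxBl (mulmxDl A) -scalemxAl -(mulmxA e) fe mulmx1.
  rewrite -(mulmxA w) re mul_mx_scalar scalerA.
  by rewrite mulmxBl mulmxDl -scalemxAl.
have D'D'U : D' *m D' *m U = D *m D *m U + e *m u.
  by rewrite D'D' mulmxDl -(mulmxA e).
rewrite /partial_cayley D'D'U D'D' D'U addrA mulmxDr A'X -scalemxAr A'eu AX.
have -> : w *m u = d *: (a *m u) + (1 + 2 * d) *: (e *m u).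
  by rewrite /w mulmxDl -!scalemxAl.
move: (a *m u) (e *m u) (e *m f) => au eu ef.
apply/matrixP => i j; rewrite !mxE.
by field.
Qed.

(** With X = I + V, the relation S X = I - V gives (I + S) X = 2 I, and
    X^T (S^T + S) X = (I - V)^T (I + V) + (I + V)^T (I - V) = 0
    by orthogonality of V. *)
Lemma cayley_rep_of_partial (R : realType) n (U D S : 'M[R]_n) :
  orthogonal_mx U -> partial_sign_diag n D -> partial_cayley U D S ->
  cayley_rep U D S.
Proof.
case=> _ UU [Ddiag Dval] SX.
have Dsign i : D i i = -1 \/ D i i = 1 by have := Dval i; rewrite ltn_ord.
have /diag_mxP [v Dv] := Ddiag.
have DT : D^T = D by rewrite Dv tr_diag_mx.
have DD : D *m D = 1%:M.
  rewrite {1 2}Dv mulmx_diag; apply/matrixP => i j; rewrite !mxE.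
  have -> : v 0 i = D i i by rewrite Dv !mxE eqxx.
  by case: (Dsign i) => ->; rewrite ?mulrNN mulr1.
pose V := D *m U.
have {}SX : S *m (1%:M + V) = 1%:M - V.
  by rewrite SX DD mul1mx -/V addrAC (addrC U) addrK.
have VV : V^T *m V = 1%:M.
  by rewrite /V trmx_mul DT -mulmxA (mulmxA D) DD mul1mx.
have inv : (1%:M + S) *m (2^-1 *: (1%:M + V)) = 1%:M.
  rewrite -scalemxAr mulmxDl mul1mx SX; apply/matrixP => i j; rewrite !mxE.
  by field.
have [SU XU] := mulmx1_unit inv.
have X_unit : 1%:M + V \in unitmx.
  by rewrite unitmxZ ?unitfE ?invr_eq0 ?pnatr_eq0 in XU.
split=> //.
- have : (1%:M + V)^T *m (S^T + S) *m (1%:M + V) = 0.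
    rewrite (mulmxDr _ S^T) mulmxDl -trmx_mul -mulmxA SX.
    rewrite !linearD !linearN /= trmx1 !(mulmxDl, mulmxDr, mulmxN, mulNmx).
    rewrite VV !mulmx1 !mul1mx; apply/matrixP => i j; rewrite !mxE; ring.
  move/(congr1 (mulmx^~ (invmx (1%:M + V)))); rewrite mulmxK // mul0mx.
  move/(congr1 (mulmx (invmx (1%:M + V)^T))).
  rewrite mulKmx ?unitmx_tr // mulmx0.
  by move/eqP; rewrite addr_eq0 => /eqP.
- have -> : invmx (1%:M + S) = 2^-1 *: (1%:M + V).
    by rewrite -[LHS]mulmx1 -[X in _ *m X]inv mulKmx.
  rewrite -mulmxA -scalemxAr mulmxBl mul1mx SX.
  have -> : 2^-1 *: (1%:M + V - (1%:M - V)) = V.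
    by apply/matrixP => i j; rewrite !mxE; field.
  by rewrite /V mulmxA DD mul1mx.
Qed.

(** * Total correctness with a cost bound *)

Definition within (R : realType) (p : prog) (s : state R) (c : nat)
    (Q : state R -> Prop) : Prop :=
  exists t k, [/\ exec p s t k, (k <= c)%N & Q t].

Lemma within_weaken (R : realType) p (s : state R) c c'
    (Q Q' : state R -> Prop) :
  (c <= c')%N -> (forall t, Q t -> Q' t) -> within p s c Q -> within p s c' Q'.
Proof.
move=> cc' QQ' [t [k [pt kc /QQ' Qt]]]; exists t, k; split=> //.
exact: leq_trans cc'.
Qed.

Lemma within_iset (R : realType) x e (s : state R) (Q : state R -> Prop) :
  Q (set_reg s x (ieval s e)) -> within (Iset x e) s 0 Q.
Proof. by move=> Qs; do 2!eexists; split; [exact: exec_iset | | exact: Qs]. Qed.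

Lemma within_rset (R : realType) a e1 e2 e v (s : state R)
    (Q : state R -> Prop) :
  reval s e = Some v -> Q (set_arr s a (ieval s e1) (ieval s e2) v) ->
  within (Rset a e1 e2 e) s (rcost e) Q.
Proof.
by move=> ev Qs; do 2!eexists; split; [exact: exec_rset ev | | exact: Qs].
Qed.

Lemma within_seq (R : realType) p q (s : state R) c c' (P Q : state R -> Prop) :
  within p s c P -> (forall t, P t -> within q t c' Q) ->
  within (Seq p q) s (c + c') Q.
Proof.
move=> [t [k [pt kc Pt]]] /(_ t Pt) [u [l [qu lc Qu]]].
by exists u, (k + l)%N; split; [exact: exec_seq pt qu | exact: leq_add |].
Qed.

Lemma within_if (R : realType) b t p q (s : state R) c (Q : state R -> Prop) :
  teval s t = Some b -> within (if b then p else q) s c Q ->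
  within (If t p q) s (tcost t + c) Q.
Proof.
move=> tb [u [k [pu kc Qu]]]; exists u, (tcost t + k)%N.
by split; [exact: exec_if tb pu | rewrite leq_add2l |].
Qed.

Definition For (x : nat) (body : prog) : prog :=
  Seq (Iset x (Inat 0))
    (While (Ilt (Ireg x) (Ireg 0))
       (Seq body (Iset x (Iadd (Ireg x) (Inat 1))))).

(** The invariant is read at the head of the loop, where the counter x already
    holds the index of the next iteration.  The body may use x but must restore
    it, and must not change the bound in register 0. *)
Lemma within_for (R : realType) x body n c (Inv : nat -> state R -> Prop)
    (s : state R) :
  x != 0%N -> reg s 0 = n -> Inv 0 (set_reg s x 0) ->
  (forall i t, (i < n)%N -> reg t 0 = n -> reg t x = i -> Inv i t ->
     within body t c (fun t' =>
       [/\ reg t' 0 = n, reg t' x = i & Inv i.+1 (set_reg t' x i.+1)])) ->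
  within (For x body) s (n * c) (fun t => reg t 0 = n /\ Inv n t).
Proof.
move=> x0 sn Inv0 step; rewrite -[(n * c)%N]add0n.
apply: (@within_seq _ _ _ _ _ _
  (fun t => [/\ reg t 0 = n, reg t x = 0%N & Inv 0 t])).
  by apply: within_iset; rewrite /= eqxx eq_sym (negbTE x0).
suff loop m i t : (i + m)%N = n -> reg t 0 = n -> reg t x = i -> Inv i t ->
    within (While (Ilt (Ireg x) (Ireg 0))
              (Seq body (Iset x (Iadd (Ireg x) (Inat 1))))) t (m * c)
      (fun t => reg t 0 = n /\ Inv n t).
  by move=> t [tn tx tInv]; apply: loop tn tx tInv.
elim: m i t => [|m IHm] i t + tn tx tInv.
  rewrite addn0 => i_n; exists t, 0%N.
  split=> //; last by rewrite -[in Inv _ _]i_n.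
  by apply: (@exec_while_stop R (Ilt _ _)); rewrite /= tx tn i_n ltnn.
move=> im; have lt_in : (i < n)%N by rewrite -im addnS ltnS leq_addr.
have [u [k [bu kc [un ux uInv]]]] := step i t lt_in tn tx tInv.
have [||||v [l [wv lc Qv]]] := IHm i.+1 (set_reg u x i.+1).
- by rewrite addSnnS.
- by rewrite /= eq_sym (negbTE x0).
- by rewrite /= eqxx.
- exact: uInv.
exists v, (0 + (k + 0) + l)%N; split=> //.
  apply: (@exec_while_step R (Ilt _ _)) wv; first by rewrite /= tx tn lt_in.
  apply: exec_seq bu _; have -> : i.+1 = (reg u x + 1)%N by rewrite ux addn1.
  exact: exec_iset.
by rewrite add0n addn0 mulSn leq_add.
Qed.

(** * Filling an array *)

(** Registers 2 and 3 are left out: they count the rows and columns when an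
    array is filled. *)
Definition same_but (R : realType) (a : nat) (s t : state R) : Prop :=
  [/\ reg t 0 = reg s 0, reg t 1 = reg s 1
    & forall b i j, b != a -> arr t b i j = arr s b i j].

Definition Fill (a : nat) (e : rexp) : prog :=
  For 2 (For 3 (Rset a (Ireg 2) (Ireg 3) e)).

Lemma same_but_read (R : realType) a (s t : state R) n b :
  same_but a s t -> b != a -> read_mx n t b = read_mx n s b.
Proof. by case=> _ _ st ba; apply/matrixP => i j; rewrite !mxE st. Qed.

(** The expression is evaluated in states where array a is partly overwritten,
    hence the premise ranges over all states that agree with s off a. *)
Lemma within_fill (R : realType) a e n (F : 'M[R]_n) (s : state R) :
  reg s 0 = n ->
  (forall (i j : 'I_n) t, same_but a s t -> reg t 2 = i -> reg t 3 = j ->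
     reval t e = Some (F i j)) ->
  within (Fill a e) s (n * (n * rcost e))
    (fun t => same_but a s t /\ read_mx n t a = F).
Proof.
move=> sn Fe.
pose filled (i j : nat) (t : state R) := same_but a s t /\
  forall i' j' : 'I_n, (i' < i)%N || (i' == i :> nat) && (j' < j)%N ->
  arr t a i' j' = F i' j'.
apply: (within_weaken (leqnn _) (Q := fun t => reg t 0 = n /\ filled n 0%N t)).
  move=> t [_ [st tF]]; split=> //.
  by apply/matrixP => i j; rewrite mxE tF // ltn_ord.
apply: (@within_for _ _ _ _ _ (fun i => filled i 0%N)) => //.
  by split=> // i' j'; rewrite ltn0 andbF.
move=> i t lt_in tn ti tF.
apply: (within_weaken (leqnn _)
  (Q := fun t' => reg t' 0 = n /\ (reg t' 2 = i /\ filled i n t'))).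
  move=> u [un [ui [su uF]]]; split=> //; split=> // i' j'.
  rewrite andbF orbF ltnS leq_eqVlt orbC => i'i.
  by apply: uF; rewrite ltn_ord andbT.
apply: (@within_for _ _ _ _ _
  (fun j t' => reg t' 2 = i /\ filled i j t')) => //.
move=> j u lt_jn un uj [ui [su uF]].
apply: within_rset; first exact: (Fe (Ordinal lt_in) (Ordinal lt_jn)).
split=> //; split=> //; split.
  case: su => s0 s1 sb; split=> // b k l ba /=.
  by rewrite (negbTE ba) sb.
move=> i' j' /=; rewrite ui uj eqxx /=.
have [i'i|i'i] := eqVneq (i' : nat) i; last first.
  by rewrite /= orbF => lt_i'i; apply: uF; rewrite lt_i'i.
have [j'j _|j'j] := eqVneq (j' : nat) j.
  by congr (F _ _); apply: val_inj.
rewrite i'i ltnn ltnS leq_eqVlt (negbTE j'j) /= => lt_j'j.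
by rewrite -[in LHS]i'i; apply: uF; rewrite i'i eqxx lt_j'j orbT.
Qed.

(** * The program *)

(** Entry (i, j) of [cayley_update], with i, j, k in registers 2, 3, 1. *)
Definition update_expr : rexp :=
  let A i j := Rget 0 (Ireg i) (Ireg j) in
  let D i j := Rget 1 (Ireg i) (Ireg j) in
  Rop Osub (Rop Oadd (A 2 3) (Rop Omul (D 2 1) (D 1 3)))
    (Rop Odiv
      (Rop Omul
        (Rop Oadd (Rop Omul (D 1 1) (A 2 1))
                  (Rop Omul (Rop Oadd (D 1 1) (Rlit 2)) (D 2 1)))
        (A 1 3))
      (Rop Oadd (Rlit 1) (Rop Omul (D 1 1) (A 1 1)))).

Lemma mul_col_row (R : realType) n (A B : 'M[R]_n) k i j :
  (col k A *m row k B) i j = A i k * B k j.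
Proof. by rewrite mxE big_ord1 !mxE. Qed.

Lemma reval_update_expr (R : realType) n (A D : 'M[R]_n) (i j k : 'I_n)
    (t : state R) :
  read_mx n t 0 = A -> read_mx n t 1 = D -> 1 + D k k * A k k != 0 ->
  reg t 1 = k -> reg t 2 = i -> reg t 3 = j ->
  reval t update_expr = Some (cayley_update A D k i j).
Proof.
move=> tA tD q0 tk ti tj.
have getA (x y : 'I_n) : arr t 0 x y = A x y by rewrite -tA mxE.
have getD (x y : 'I_n) : arr t 1 x y = D x y by rewrite -tD mxE.
rewrite /= tk ti tj !(getA, getD) (negbTE q0); congr Some.
have addE (M N : 'M[R]_n) : (M + N) i j = M i j + N i j by rewrite mxE.
rewrite /cayley_update addE addE [(- _ : 'M__) i j]mxE [(_ *: _ : 'M__) i j]mxE.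
rewrite !mul_col_row [(_ + _ : 'M__) i k]mxE.
rewrite 2![(_ *: _ : 'M__) i k]mxE.
by rewrite [X in _ = _ - X]mulrC.
Qed.

Definition sign_step : prog :=
  let k := Ireg 1 in
  If (Rle (Rlit 0) (Rget 2 k k)) (Rset 1 k k (Rlit 1)) (Rset 1 k k (Rlit (-1))).

Lemma within_sign_step (R : realType) n (k : 'I_n) (s : state R) :
  reg s 1 = k -> partial_sign_diag k (read_mx n s 1) ->
  within sign_step s 1 (fun t => same_but 1 s t /\
    read_mx n t 1 = read_mx n s 1
      + pivot_sign (read_mx n s 2) k *: delta_mx k k).
Proof.
move=> sk [_ /(_ k)]; rewrite ltnn mxE => Dkk.
have post v : let t := set_arr s 1 k k v in same_but 1 s t /\
    read_mx n t 1 = read_mx n s 1 + v *: delta_mx k k.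
  split=> [|/=]; first by split=> // b i j /negbTE b1; rewrite /= b1.
  apply/matrixP => i j; rewrite !mxE /=.
  rewrite -![(_ == _ :> nat)]/(_ == _ :> 'I_n).
  case: andP => [[/eqP-> /eqP->]|_]; last by rewrite mulr0 addr0.
  by rewrite Dkk add0r mulr1.
apply: (@within_if _ (0 <= read_mx n s 2 k k) _ _ _ _ 0).
  by rewrite /= sk mxE.
rewrite /pivot_sign; case: ifP => _.
  by apply: within_rset => //=; rewrite sk; exact: post.
by apply: within_rset => //=; rewrite sk; exact: post.
Qed.

Definition cayley_prog : prog :=
  Seq (Fill 2 (Rget 0 (Ireg 2) (Ireg 3)))
    (For 1 (Seq sign_step
      (Seq (Fill 0 (Rget 2 (Ireg 2) (Ireg 3))) (Fill 2 update_expr)))).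

Lemma within_copy (R : realType) a b n (s : state R) :
  b != a -> reg s 0 = n ->
  within (Fill a (Rget b (Ireg 2) (Ireg 3))) s 0
    (fun t => same_but a s t /\ read_mx n t a = read_mx n s b).
Proof.
move=> ba sn.
have := @within_fill R a (Rget b (Ireg 2) (Ireg 3)) n (read_mx n s b) s sn.
rewrite !muln0; apply=> i j t [_ _ st] ti tj.
by rewrite /= ti tj st // mxE.
Qed.

Lemma within_cayley_prog (R : realType) n (U : 'M[R]_n) :
  within cayley_prog (init_state U) (12 * n ^ 3) (fun t =>
    partial_sign_diag n (read_mx n t 1) /\
    partial_cayley U (read_mx n t 1) (read_mx n t 2)).
Proof.
pose Inv m (t : state R) := partial_sign_diag m (read_mx n t 1) /\
    partial_cayley U (read_mx n t 1) (read_mx n t 2).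
(* 1 comparison for the sign; 11 operations in [update_expr] *)
pose cost := (n * (1 + (0 + n * (n * 11))))%N.
have cost_le : (0 + cost <= 12 * n ^ 3)%N.
  rewrite /cost; case: n {U Inv cost} => // n; nia.
apply: (within_weaken cost_le (Q := fun t => reg t 0 = n /\ Inv n t)).
  by move=> t [].
apply: within_seq (within_copy _ _) _ => // t [st t2].
have initU : read_mx n (init_state U) 0 = U.
  by apply/matrixP => i j; rewrite mxE /= (valK i) (valK j).
have init0 : read_mx n (init_state U) 1 = 0.
  by apply/matrixP => i j; rewrite !mxE.
have t1 : read_mx n t 1 = 0 by rewrite (same_but_read _ st).
apply: within_for => //; first by case: st.
  rewrite /Inv /read_mx /= -/(read_mx n t 1) -/(read_mx n t 2) t1 t2 initU.
  split; first exact: partial_sign_diag0.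
  by rewrite /partial_cayley !mul0mx addr0 mulmx1 addr0 !subr0.
move=> m u lt_mn un um [uD uA]; pose k := Ordinal lt_mn.
apply: within_seq (@within_sign_step R n k u um uD) _ => v [uv v1].
have [v0 vm _] := uv.
apply: (within_seq (within_copy _ (etrans v0 un))) => //.
move=> w [vw w0]; have [w0n wm _] := vw.
have wA : read_mx n w 0 = read_mx n u 2 by rewrite w0 (same_but_read _ uv).
have w1 : read_mx n w 1 = read_mx n v 1 by rewrite (same_but_read _ vw).
have wn : reg w 0 = n by rewrite w0n v0.
have fill := @within_fill R 2 update_expr n
  (cayley_update (read_mx n w 0) (read_mx n w 1) k) w wn.
apply: within_weaken (fill _) => //; last first.
  move=> i j x wx xi xj; apply: reval_update_expr => //.
  - by rewrite (same_but_read _ wx).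
  - by rewrite (same_but_read _ wx).
  - have [_ /(_ k)] := uD; rewrite ltnn w1 v1 wA => Dkk.
    rewrite [(_ + _ : 'M__) k k]mxE Dkk add0r [(_ *: _ : 'M__) k k]mxE.
    by rewrite [delta_mx _ _ _ _]mxE eqxx mulr1 pivot_neq0.
  - by case: wx => _ -> _; rewrite wm vm.
move=> x [wx x2]; have [x0 x1 _] := wx.
split; [by rewrite x0 | by rewrite x1 wm vm |].
rewrite /Inv /read_mx /= -/(read_mx n x 1) -/(read_mx n x 2) x2.
rewrite (same_but_read _ wx) // w1 v1 wA; split.
  exact: (@partial_sign_diagS _ _ _ k _ uD (pivot_sign_cases _ _)).
exact: cayley_update_correct.
Qed.

Theorem corollary1 (R : realType) :
  (forall (n : nat) (U : 'M[R]_n), orthogonal_mx U ->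
     exists D S : 'M[R]_n, cayley_rep U D S)
  /\
  (exists (p : prog) (C : nat), forall (n : nat) (U : 'M[R]_n),
     orthogonal_mx U ->
     exists (D S : 'M[R]_n) (k : nat),
       [/\ computes_in p U D S k, (k <= C * n ^ 3)%N & cayley_rep U D S]).
Proof.
have main (n : nat) (U : 'M[R]_n) : orthogonal_mx U ->
    exists (D S : 'M[R]_n) (k : nat),
      [/\ computes_in cayley_prog U D S k, (k <= 12 * n ^ 3)%N
        & cayley_rep U D S].
  move=> Uorth; have [t [k [run cost [tD tS]]]] := within_cayley_prog U.
  exists (read_mx n t 1), (read_mx n t 2), k.
  by split; [exists t | | exact: cayley_rep_of_partial].
split=> [n U Uorth|]; last by exists cayley_prog, 12%N.
by have [D [S [k [_ _ rep]]]] := main n U Uorth; exists D, S.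
Qed.
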